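(* Suppose $f$ is twice differentiable at every point of $\mathbb{R}^{n\times p}$ and $\beta\ge\bar\beta$. Let $\tilde X\in\Omega$ satisfy $\nabla h(\tilde X)=0$ and $\tilde X^\top\tilde X\ne I_p$. Then $\tilde X$ is not a second-order stationary point of $h$; more precisely, $\lambda_{\min}(\nabla^2 h(\tilde X))\le-\beta/24$.
   Context: $f:\mathbb{R}^{n\times p}\to\mathbb{R}$ is differentiable with $f$ and $\nabla f$ locally Lipschitz. $\mathcal{A}(X):=\frac32I_p-\frac12X^\top X$, $g(X):=f(X\mathcal{A}(X))$, $h(X):=g(X)+\frac\beta4\|X^\top X-I_p\|_F^2$ with $\beta>0$, $G(X):=\nabla f(Y)|_{Y=X\mathcal{A}(X)}$. A point $X$ is a second-order stationary point of $h$ if $\nabla h(X)=0$ and $\langle \nabla^2h(X)[D],D\rangle\ge0$ for all $D\in\mathbb{R}^{n\times p}$, where $\langle A,B\rangle=\mathrm{tr}(A^\top B)$; $\lambda_{\min}(\nabla^2h(X)):=\min_{\|D\|_F=1}\langle D,\nabla^2h(X)[D]\rangle$. $\Omega:=\{X:\|X\|_2\le1+\frac1{12}\}$. $M_1:=\sup_{X\in\Omega}\|G(X)\|_F$, $M_2:=\sup_{X\ne Y\in\Omega}\frac{\|\nabla g(X)-\nabla g(Y)\|_F}{\|X-Y\|_F}$, $\bar\beta:=\max\{12M_1,6M_2\}$.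
   Formalization: The formal statement adds the assumption p ≤ n (the Stiefel setting); for n < p the claim is false, e.g. f = 0 and X with orthonormal rows, a global minimizer of h with XᵀX ≠ I_p. *)

(* Defs.v *)
From HB Require Import structures.
From mathcomp Require Import all_boot all_order all_algebra.
From mathcomp Require Import all_classical all_reals all_analysis.
Set Implicit Arguments. Unset Strict Implicit. Unset Printing Implicit Defensive.
Import Order.TTheory GRing.Theory Num.Theory.
Import numFieldNormedType.Exports.
Local Open Scope classical_set_scope.
Local Open Scope ring_scope.

Section Defs.
Variable R : realType.
Local Set Implicit Arguments.

Definition frob_inner (n p : nat) (A B : 'M[R]_(n, p)) : R := \tr (A^T *m B).
Definition normF (n p : nat) (A : 'M[R]_(n, p)) : R := Num.sqrt (frob_inner A A).

Definition norm2 (n p : nat) (X : 'M[R]_(n, p)) : R :=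
  sup [set normF (X *m v) | v in [set v : 'cV[R]_p | normF v = 1]].

Definition Omega (n p : nat) : set 'M[R]_(n, p) :=
  [set X | norm2 X <= 1 + 12^-1].
Arguments Omega : clear implicits.

Definition grad (n p : nat) (F : 'M[R]_(n, p) -> R) (X : 'M[R]_(n, p))
  : 'M[R]_(n, p) := \matrix_(i, j) ('d F X (delta_mx i j)).

Definition hess_quad (n p : nat) (F : 'M[R]_(n, p) -> R) (X D : 'M[R]_(n, p))
  : R := frob_inner D ('d (grad F) X D).

Definition lambda_min (n p : nat) (F : 'M[R]_(n, p) -> R) (X : 'M[R]_(n, p))
  : R := inf [set hess_quad F X D | D in [set D : 'M[R]_(n, p) | normF D = 1]].

Definition calA (n p : nat) (X : 'M[R]_(n, p)) : 'M[R]_p :=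
  (3 / 2) *: 1%:M - (1 / 2) *: (X^T *m X).

Definition gfun (n p : nat) (f : 'M[R]_(n, p) -> R) (X : 'M[R]_(n, p)) : R :=
  f (X *m calA X).

Definition hfun (n p : nat) (f : 'M[R]_(n, p) -> R) (beta : R)
  (X : 'M[R]_(n, p)) : R :=
  gfun f X + beta / 4 * normF (X^T *m X - 1%:M) ^+ 2.

Definition Gfun (n p : nat) (f : 'M[R]_(n, p) -> R) (X : 'M[R]_(n, p))
  : 'M[R]_(n, p) := grad f (X *m calA X).

Definition M1 (n p : nat) (f : 'M[R]_(n, p) -> R) : \bar R :=
  ereal_sup [set (normF (Gfun f X))%:E | X in Omega n p].

Definition M2 (n p : nat) (f : 'M[R]_(n, p) -> R) : \bar R :=
  ereal_sup [set e | exists X Y : 'M[R]_(n, p),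
     [/\ Omega n p X, Omega n p Y, X != Y &
      e = (normF (grad (gfun f) X - grad (gfun f) Y) / normF (X - Y))%:E]].

Definition beta_bar (n p : nat) (f : 'M[R]_(n, p) -> R) : \bar R :=
  maxe (12%:E * M1 f)%E (6%:E * M2 f)%E.

Definition locally_lipschitz (n p : nat) (V : normedModType R)
  (F : 'M[R]_(n, p) -> V) : Prop :=
  forall X : 'M[R]_(n, p), exists r : R, exists L : R, 0 < r /\
    forall Y Z : 'M[R]_(n, p), normF (Y - X) < r -> normF (Z - X) < r ->
      `|F Y - F Z| <= L * normF (Y - Z).

Definition second_order_stationary (n p : nat) (F : 'M[R]_(n, p) -> R)
  (X : 'M[R]_(n, p)) : Prop :=
  grad F X = 0 /\ forall D : 'M[R]_(n, p), 0 <= hess_quad F X D.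

End Defs.
Arguments Omega {R} n p.

(* Main.v *)
Require Import Defs.
From HB Require Import structures.
From mathcomp Require Import all_boot all_order all_algebra.
From mathcomp Require Import all_classical all_reals all_analysis.
From mathcomp Require Import ring lra.
Import Order.TTheory GRing.Theory Num.Theory.
Import numFieldNormedType.Exports.
Local Open Scope classical_set_scope.
Local Open Scope ring_scope.

(* Write P = X^T X.  Testing the stationarity equation against X v for a unit
   eigenvector P v = lam v gives (lam - 1)(beta lam - (3/2) <X v, G v>) = 0, and
   beta >= 12 M1 then forces lam = 1 or lam <= 1/64.  In particular X is a
   contraction, hence interior to Omega, so that beta >= 6 M2 bounds the Hessian
   of g at X by beta/6 in every direction.  If P <> I, the least eigenvalue lam
   of P is at most 1/64; with v its unit eigenvector and u a matching unit left
   singular vector (which exists because p <= n), the penalty has Hessian at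
   most beta (3/64 - 1) along D = u v^T. *)

Local Set Implicit Arguments.
Local Unset Strict Implicit.

(** * Differential calculus for matrix-valued maps *)

Section MatrixDifferential.
Context {R : realType}.

(** Lets each derivative below be built from combinators and then matched pointwise with the desired
    closed form. *)
Lemma is_diff_fun (V W : normedModType R) (x : V) (F F' dF dF' : V -> W) :
  is_diff x F dF -> F =1 F' -> dF =1 dF' -> is_diff x F' dF'.
Proof. by move=> h /funext <- /funext <-. Qed.

Lemma is_diff_sum (V W : normedModType R) (I : Type) (r : seq I)
    (F dF : I -> V -> W) (x : V) :
  (forall i, is_diff x (F i) (dF i)) ->
  is_diff x (fun y => \sum_(i <- r) F i y) (fun v => \sum_(i <- r) dF i v).
Proof.
move=> dFx; elim: r => [|i r IH].
  by apply: (is_diff_fun (is_diff_cst 0 x)) => y; rewrite big_nil.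
by apply: (is_diff_fun (is_diffD (dFx i) IH)) => y; rewrite big_cons.
Qed.

(** Finite dimension is what matters: expanded in the basis [delta_mx i j], [L] is a finite sum of
    coordinate functions times fixed vectors. *)
Lemma linear_mx_continuous (m n : nat) (W : normedModType R)
    (L : {linear 'M[R]_(m, n) -> W}) : continuous L.
Proof.
have -> : L = (fun A => \sum_i \sum_j A i j *: L (delta_mx i j)) :> (_ -> _).
  apply/funext => A; rewrite [in LHS](matrix_sum_delta A) linear_sum.
  by apply: eq_bigr => i _; rewrite linear_sum; apply: eq_bigr => j _; rewrite linearZ_LR.
move=> A.
have dL i j := differentiableP (differentiableZl (L (delta_mx i j)) (differentiable_coord A i j)).
have [dsum _] := is_diff_sum (index_enum _) (fun i => is_diff_sum (index_enum _) (dL i)).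
exact: differentiable_continuous dsum.
Qed.

Lemma is_diff_linear (V W : normedModType R) (m n : nat)
    (L : {linear 'M[R]_(m, n) -> W}) (x : V) (F dF : V -> 'M[R]_(m, n)) :
  is_diff x F dF -> is_diff x (fun y => L (F y)) (fun v => L (dF v)).
Proof.
move=> dFx; apply: is_diff_comp.
have cL : continuous L by exact: linear_mx_continuous.
by apply: DiffDef; [exact: linear_differentiable | rewrite diff_lin].
Qed.

Lemma is_diff_coord (V : normedModType R) (m n : nat) (x : V)
    (F dF : V -> 'M[R]_(m, n)) i j :
  is_diff x F dF -> is_diff x (fun y => F y i j) (fun v => dF v i j).
Proof.
move=> dFx; pose c (A : 'M[R]_(m, n)) : R := A i j.
have c_lin : linear c by move=> a A B; rewrite /c !mxE.
pose cM := GRing.isLinear.Build _ _ _ _ _ c_lin.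
pose cL : {linear _ -> _} := HB.pack c cM.
exact: (is_diff_linear cL).
Qed.

Lemma is_diff_mx (V : normedModType R) (m n : nat) (x : V)
    (F dF : V -> 'M[R]_(m, n)) :
  (forall i j, is_diff x (fun y => F y i j) (fun v => dF v i j)) ->
  is_diff x F dF.
Proof.
move=> dFx; apply: (@is_diff_fun _ _ _
  (fun y => \sum_i \sum_j F y i j *: delta_mx i j) F
  (fun v => \sum_i \sum_j dF v i j *: delta_mx i j)); first last.
- by move=> v; rewrite -matrix_sum_delta.
- by move=> v; rewrite -matrix_sum_delta.
apply: (is_diff_sum _ (fun i => is_diff_sum _ (fun j => _))) => i j.
exact: (is_diff_comp (dFx _ _) (is_diff_scalel _ _)).
Qed.

(** Entrywise this is the scalar product rule summed over the inner index. *)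
Lemma is_diff_mulmx (V : normedModType R) (m n p : nat) (x : V)
    (F dF : V -> 'M[R]_(m, n)) (G dG : V -> 'M[R]_(n, p)) :
  is_diff x F dF -> is_diff x G dG ->
  is_diff x (fun y => F y *m G y) (fun v => dF v *m G x + F x *m dG v).
Proof.
move=> dFx dGx; apply: is_diff_mx => i j.
apply: (@is_diff_fun _ _ _ (fun y => \sum_k F y i k * G y k j) _
  (fun v => \sum_k (F x i k * dG v k j + G x k j * dF v i k))); last first.
- move=> v; rewrite !mxE -big_split; apply: eq_bigr => k _.
  by rewrite addrC [G x k j * _]mulrC.
- by move=> y; rewrite mxE.
apply: is_diff_sum => k.
exact: (is_diffM (is_diff_coord i k dFx) (is_diff_coord k j dGx)).
Qed.

End MatrixDifferential.

(** * The Frobenius inner product and norm *)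

Section Frobenius.
Context {R : realType}.

Lemma frob_innerE (m n : nat) (A B : 'M[R]_(m, n)) :
  frob_inner A B = \sum_i \sum_j A i j * B i j.
Proof.
rewrite /frob_inner /mxtrace exchange_big; apply: eq_bigr => j _.
by rewrite mxE; apply: eq_bigr => i _; rewrite mxE.
Qed.

Lemma frob_innerC (m n : nat) (A B : 'M[R]_(m, n)) :
  frob_inner A B = frob_inner B A.
Proof. by rewrite /frob_inner -mxtrace_tr trmx_mul trmxK. Qed.

Lemma frob_inner_is_linear (m n : nat) (A : 'M[R]_(m, n)) :
  linear (frob_inner A).
Proof. by move=> a B C; rewrite /frob_inner mulmxDr -scalemxAr linearP. Qed.

(** The linear structure gives access to the generic [linear] lemmas and to [is_diff_linear]. *)
HB.instance Definition _ (m n : nat) (A : 'M[R]_(m, n)) :=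
  GRing.isLinear.Build R 'M[R]_(m, n) R _ (frob_inner A)
    (frob_inner_is_linear A).

Lemma frob_innerDr (m n : nat) (A B C : 'M[R]_(m, n)) :
  frob_inner A (B + C) = frob_inner A B + frob_inner A C.
Proof. exact: linearD. Qed.

Lemma frob_innerDl (m n : nat) (A B C : 'M[R]_(m, n)) :
  frob_inner (A + B) C = frob_inner A C + frob_inner B C.
Proof. by rewrite !(frob_innerC _ C) linearD. Qed.

Lemma frob_innerZr (m n : nat) a (A B : 'M[R]_(m, n)) :
  frob_inner A (a *: B) = a * frob_inner A B.
Proof. exact: linearZ_LR. Qed.

Lemma frob_innerZl (m n : nat) a (A B : 'M[R]_(m, n)) :
  frob_inner (a *: A) B = a * frob_inner A B.
Proof. by rewrite !(frob_innerC _ B) frob_innerZr. Qed.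

Lemma frob_innerNr (m n : nat) (A B : 'M[R]_(m, n)) :
  frob_inner A (- B) = - frob_inner A B.
Proof. exact: linearN. Qed.

Lemma frob_innerNl (m n : nat) (A B : 'M[R]_(m, n)) :
  frob_inner (- A) B = - frob_inner A B.
Proof. by rewrite !(frob_innerC _ B) frob_innerNr. Qed.

Lemma frob_inner_tr (m n : nat) (A B : 'M[R]_(m, n)) :
  frob_inner A^T B^T = frob_inner A B.
Proof. by rewrite /frob_inner trmxK mxtrace_mulC -mxtrace_tr trmx_mul trmxK. Qed.

Lemma frob_inner_mulmxl (m n p : nat) (A : 'M[R]_(m, n)) (B : 'M[R]_(n, p))
    (C : 'M[R]_(m, p)) :
  frob_inner (A *m B) C = frob_inner B (A^T *m C).
Proof. by rewrite /frob_inner trmx_mul mulmxA. Qed.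

Lemma frob_inner_mulmxr (m n p : nat) (A : 'M[R]_(m, n)) (B : 'M[R]_(n, p))
    (C : 'M[R]_(m, p)) :
  frob_inner (A *m B) C = frob_inner A (C *m B^T).
Proof. by rewrite /frob_inner trmx_mul -mulmxA mxtrace_mulC mulmxA. Qed.

Lemma frob_inner_ge0 (m n : nat) (A : 'M[R]_(m, n)) : 0 <= frob_inner A A.
Proof.
by rewrite frob_innerE; do 2![apply: sumr_ge0 => ? _]; rewrite -expr2 sqr_ge0.
Qed.

Lemma frob_inner_eq0 (m n : nat) (A : 'M[R]_(m, n)) :
  frob_inner A A = 0 -> A = 0.
Proof.
rewrite frob_innerE => /eqP A0; apply/matrixP => i j; rewrite mxE.
move: A0; rewrite psumr_eq0; last first.
  by move=> k _; apply: sumr_ge0 => ? _; rewrite -expr2 sqr_ge0.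
move=> /allP /(_ i); rewrite mem_index_enum => /(_ isT) /=.
rewrite psumr_eq0; last by move=> ? _; rewrite -expr2 sqr_ge0.
move=> /allP /(_ j); rewrite mem_index_enum => /(_ isT) /=.
by rewrite mulf_eq0 orbb => /eqP.
Qed.

Lemma frob_inner_delta (m n : nat) (A : 'M[R]_(m, n)) i j :
  frob_inner A (delta_mx i j) = A i j.
Proof.
rewrite frob_innerE (bigD1 i)//= (bigD1 j)//= !mxE !eqxx mulr1.
rewrite !big1 ?addr0// => k ki.
  by rewrite big1 // => l _; rewrite mxE (negPf ki) mulr0.
by rewrite mxE (negPf ki) andbF mulr0.
Qed.

Lemma normF_ge0 (m n : nat) (A : 'M[R]_(m, n)) : 0 <= normF A.
Proof. exact: sqrtr_ge0. Qed.

Lemma sqr_normF (m n : nat) (A : 'M[R]_(m, n)) :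
  normF A ^+ 2 = frob_inner A A.
Proof. by rewrite sqr_sqrtr // frob_inner_ge0. Qed.

Lemma normF0 (m n : nat) : normF (0 : 'M[R]_(m, n)) = 0.
Proof. by rewrite /normF linear0 sqrtr0. Qed.

Lemma normF_gt0 (m n : nat) (A : 'M[R]_(m, n)) : (0 < normF A) = (A != 0).
Proof.
rewrite lt_def normF_ge0 andbT; congr (~~ _); apply/eqP/eqP => [A0|->].
  by apply: frob_inner_eq0; rewrite -sqr_normF A0 expr0n.
exact: normF0.
Qed.

Lemma normFZ (m n : nat) a (A : 'M[R]_(m, n)) :
  normF (a *: A) = `|a| * normF A.
Proof.
by rewrite /normF frob_innerZl frob_innerZr mulrA -expr2 sqrtrM ?sqr_ge0 // sqrtr_sqr.
Qed.

Lemma normF_tr (m n : nat) (A : 'M[R]_(m, n)) : normF A^T = normF A.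
Proof. by rewrite /normF frob_inner_tr. Qed.

Lemma normF1 (m n : nat) (A : 'M[R]_(m, n)) :
  normF A = 1 <-> frob_inner A A = 1.
Proof.
split=> [A1|A1]; first by rewrite -sqr_normF A1 expr1n.
by rewrite /normF A1 sqrtr1.
Qed.

Lemma frob_CauchySchwarz (m n : nat) (A B : 'M[R]_(m, n)) :
  `|frob_inner A B| <= normF A * normF B.
Proof.
rewrite -(@ler_pXn2r _ 2) ?nnegrE ?normr_ge0 ?mulr_ge0 ?normF_ge0 //.
rewrite exprMn !sqr_normF real_normK ?num_real //.
have [->|B0] := eqVneq B 0.
  by rewrite !linear0 expr0n mulr0.
have BB : 0 < frob_inner B B by rewrite -sqr_normF exprn_gt0 // normF_gt0.
(* With a = <A,A>, b = <B,B>, c = <A,B>, the squared norm of b A - c B is b (a b - c^2); this form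
   of the projection argument avoids division. *)
have := frob_inner_ge0 (frob_inner B B *: A - frob_inner A B *: B).
rewrite frob_innerDl !frob_innerDr !(frob_innerNl, frob_innerNr)
  !(frob_innerZl, frob_innerZr) (frob_innerC B A).
set a := frob_inner A A; set b := frob_inner B B; set c := frob_inner A B.
move=> h; rewrite -(ler_pM2l BB) -/b; nra.
Qed.

Lemma normFD (m n : nat) (A B : 'M[R]_(m, n)) :
  normF (A + B) <= normF A + normF B.
Proof.
rewrite -(@ler_pXn2r _ 2) ?nnegrE ?addr_ge0 ?normF_ge0 //.
rewrite sqrrD !sqr_normF frob_innerDl !frob_innerDr (frob_innerC B A).
have := le_trans (ler_norm _) (frob_CauchySchwarz A B).
by rewrite mulr2n; lra.
Qed.

Lemma normF_mul_vecT (m n : nat) (u : 'cV[R]_m) (v : 'cV[R]_n) :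
  normF (u *m v^T) = normF u * normF v.
Proof.
rewrite -[RHS]ger0_norm ?mulr_ge0 ?normF_ge0 // -sqrtr_sqr; congr Num.sqrt.
rewrite exprMn !sqr_normF frob_inner_mulmxl.
rewrite mulmxA [u^T *m u]mx11_scalar mul_scalar_mx frob_innerZr frob_inner_tr.
by rewrite -trace_mx11.
Qed.

(** Moving [v] across the inner product gives |Av|^2 = <A, (Av) v^T>, and the rank-one factor has
    norm |Av| |v|; then Cauchy-Schwarz applies and |Av| cancels. *)
Lemma normF_mul_vec (m n : nat) (A : 'M[R]_(m, n)) (v : 'cV[R]_n) :
  normF (A *m v) <= normF A * normF v.
Proof.
have [->|Av] := eqVneq (A *m v) 0.
  by rewrite normF0 mulr_ge0 ?normF_ge0.
rewrite -normF_gt0 in Av; rewrite -(ler_pM2r Av) -expr2 sqr_normF.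
rewrite frob_inner_mulmxr; apply: le_trans (ler_norm _) _.
apply: le_trans (frob_CauchySchwarz _ _) _.
by rewrite normF_mul_vecT -mulrA (mulrC (normF v)).
Qed.

End Frobenius.

(** * Extremal eigenvectors of symmetric matrices *)

Section SymmetricMatrices.
Context {R : realType}.

Lemma is_diff_frob_inner (V : normedModType R) (m n : nat) (x : V)
    (F dF G dG : V -> 'M[R]_(m, n)) :
  is_diff x F dF -> is_diff x G dG ->
  is_diff x (fun y => frob_inner (F y) (G y))
            (fun v => frob_inner (dF v) (G x) + frob_inner (F x) (dG v)).
Proof.
move=> dFx dGx; have dtF := is_diff_linear (@trmx R m n) dFx.
apply: (is_diff_fun (is_diff_linear (@mxtrace R n) (is_diff_mulmx dtF dGx))) => //.
by move=> v; rewrite linearD.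
Qed.

(** Stated for row vectors, the form in which [EVT_min_rV] takes its compact set. The ambient norm
    is the maximum of the entries, each of which is at most 1 in absolute value on the Euclidean
    sphere. *)
Lemma unit_rV_compact (n : nat) :
  compact [set r : 'rV[R]_n | frob_inner r r = 1].
Proof.
apply: bounded_closed_compact.
  exists 1; split; first exact: num_real.
  move=> M M1 r /= r1; apply: le_trans (ltW M1).
  rewrite [`|r|]mx_normrE; apply: bigmax_le => // -[i j] _ /=.
  rewrite -(@ler_pXn2r _ 2) ?nnegrE ?normr_ge0 // real_normK ?num_real //.
  rewrite expr1n -r1 frob_innerE (bigD1 i)//= (bigD1 j)//= -expr2 -addrA lerDl.
  apply: addr_ge0; first by apply: sumr_ge0 => ? _; rewrite -expr2 sqr_ge0.
  by do 2![apply: sumr_ge0 => ? _]; rewrite -expr2 sqr_ge0.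
apply: (@closed_comp _ _ (fun r : 'rV[R]_n => frob_inner r r) [set 1]).
  move=> r _; have [d _] := is_diff_frob_inner (is_diff_id r) (is_diff_id r).
  exact: differentiable_continuous d.
exact: closed_eq.
Qed.

(** The form is nonnegative along the line v + t Bv and vanishes at t = 0, so its linear coefficient
    2 |Bv|^2 must vanish. *)
Lemma psd_ker (n : nat) (B : 'M[R]_n) (v : 'cV[R]_n) :
  B^T = B -> (forall w : 'cV[R]_n, 0 <= frob_inner w (B *m w)) ->
  frob_inner v (B *m v) = 0 -> B *m v = 0.
Proof.
move=> Bsym Bpsd Bv0; apply: frob_inner_eq0.
set w := B *m v; set a := frob_inner w w; set b := frob_inner w (B *m w).
have a0 : 0 <= a by exact: frob_inner_ge0.
have b0 : 0 <= b by exact: Bpsd.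
apply/eqP; rewrite eq_le a0 andbT leNgt; apply/negP => agt0.
have quad t : 0 <= 2 * t * a + t ^+ 2 * b.
  apply: le_trans (Bpsd (v + t *: w)) _.
  rewrite mulmxDr -scalemxAr frob_innerDl !frob_innerDr !frob_innerZl
    !frob_innerZr Bv0 -/w -/a -/b.
  have -> : frob_inner v (B *m w) = a by rewrite frob_innerC frob_inner_mulmxl Bsym.
  by lra.
clear Bsym Bpsd Bv0.
have b1 : b + 1 != 0 by rewrite gt_eqF //; lra.
(* The shift to b + 1 keeps the denominator positive even when b = 0; the value of the quadratic
   there is negative as soon as a > 0. *)
have := quad (- a / (b + 1)).
have -> : 2 * (- a / (b + 1)) * a + (- a / (b + 1)) ^+ 2 * b =
   - ((a / (b + 1)) ^+ 2 * (b + 2)) by field.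
rewrite oppr_ge0 leNgt mulr_gt0 //; last by lra.
by rewrite exprn_gt0 // divr_gt0 //; lra.
Qed.

Lemma sym_quadratic_form_eq0 (n : nat) (B : 'M[R]_n) :
  B^T = B -> (forall w : 'cV[R]_n, frob_inner w (B *m w) = 0) -> B = 0.
Proof.
move=> Bsym B0; apply/matrixP => i j; rewrite mxE.
have -> : B i j = (B *m delta_mx j 0 : 'cV_n) i 0 by rewrite -colE mxE.
by rewrite psd_ker ?mxE // => w; rewrite B0.
Qed.

(** Take a minimiser c of the quadratic form on the unit sphere, with minimum q(c). Then S - q(c) I
    is positive semidefinite and its form vanishes at c, so [psd_ker] yields the eigenvector
    equation without Lagrange multipliers. *)
Lemma min_eigenvector (n : nat) (S : 'M[R]_n) : (0 < n)%N -> S^T = S ->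
  exists v : 'cV[R]_n, exists lam : R,
    [/\ normF v = 1, S *m v = lam *: v &
        forall w : 'cV[R]_n, lam * frob_inner w w <= frob_inner w (S *m w)].
Proof.
case: n S => // n S _ Ssym.
pose q (r : 'rV[R]_n.+1) := frob_inner r (r *m S).
have qE (w : 'cV[R]_n.+1) : q w^T = frob_inner w (S *m w).
  by rewrite /q -{1}Ssym -trmx_mul frob_inner_tr.
have [] := @EVT_min_rV R _ q _ _ (@unit_rV_compact n.+1).
- exists (delta_mx 0 0); rewrite /= frob_inner_delta mxE !eqxx //.
- apply: continuous_subspaceT => r.
  have [d _] := is_diff_frob_inner (is_diff_id r)
    (is_diff_linear (mulmxr S) (is_diff_id r)).
  exact: differentiable_continuous d.
move=> c; rewrite inE /= => c1 cmin.
have min (w : 'cV[R]_n.+1) : q c * frob_inner w w <= frob_inner w (S *m w).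
  have [->|w0] := eqVneq w 0; first by rewrite mulmx0 !linear0 mulr0.
  rewrite -normF_gt0 in w0.
  have := cmin ((normF w)^-1 *: w)^T; rewrite qE inE /= frob_inner_tr.
  rewrite -scalemxAr !frob_innerZl !frob_innerZr !mulrA -expr2.
  have w2 : (normF w)^-1 ^+ 2 * normF w ^+ 2 = 1 by field; rewrite gt_eqF.
  rewrite sqr_normF in w2; move=> /(_ w2); rewrite exprVn sqr_normF.
  by rewrite [X in _ <= X]mulrC ler_pdivlMr // -sqr_normF exprn_gt0.
exists c^T, (q c); split => //; first by apply/normF1; rewrite frob_inner_tr.
have := @psd_ker _ (S - (q c)%:M) c^T; rewrite mulmxBl mul_scalar_mx.
move=> h; apply/eqP; rewrite -subr_eq0; apply/eqP/h.
- by rewrite linearB /= tr_scalar_mx Ssym.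
- move=> w; rewrite mulmxBl mul_scalar_mx frob_innerDr frob_innerNr frob_innerZr.
  by rewrite subr_ge0.
- rewrite frob_innerDr frob_innerNr frob_innerZr -qE trmxK frob_inner_tr c1.
  by rewrite mulr1 subrr.
Qed.

End SymmetricMatrices.

(** * Gradients and Hessians of g, of the penalty and of h *)

Section Gradients.
Context {R : realType} {n p : nat}.
Implicit Types (X Y D : 'M[R]_(n, p)) (f F : 'M[R]_(n, p) -> R).

Lemma diffE_grad F X D : 'd F X D = frob_inner (grad F X) D.
Proof.
rewrite {1}[D]matrix_sum_delta linear_sum frob_innerE; apply: eq_bigr => i _.
rewrite linear_sum; apply: eq_bigr => j _; rewrite linearZ_LR mxE.
by rewrite mulrC.
Qed.

Lemma grad_is_diff F X V : is_diff X F (frob_inner V) -> grad F X = V.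
Proof.
by move=> [_ dF]; apply/matrixP => i j; rewrite mxE dF frob_inner_delta.
Qed.

Lemma is_diff_gram X :
  is_diff X (fun Y => Y^T *m Y) (fun D => D^T *m X + X^T *m D).
Proof.
exact: is_diff_mulmx (is_diff_linear (@trmx R n p) (is_diff_id X)) (is_diff_id X).
Qed.

Lemma is_diff_mul_calA X :
  is_diff X (fun Y => Y *m calA Y)
    (fun D => D *m calA X - (1 / 2) *: (X *m (D^T *m X + X^T *m D))).
Proof.
have dA := is_diffB (is_diff_cst ((3 / 2) *: 1%:M) X)
  (is_diffZ (1 / 2) (is_diff_gram X)).
apply: (is_diff_fun (is_diff_mulmx (is_diff_id X) dA)) => // D.
rewrite /calA; congr (_ + _).
by rewrite /= !fctE; rewrite sub0r mulmxN -scalemxAr.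
Qed.

Lemma calA_sym X : (calA X)^T = calA X.
Proof. by rewrite /calA linearB !linearZ /= trmx1 trmx_mul trmxK. Qed.

(** The chain rule pairs G with the differential of Y [calA] Y; the displayed gradient is the
    adjoint of that differential applied to G, using that [calA X] is symmetric. *)
Lemma is_diff_gfun f X : (forall Y, differentiable f Y) ->
  is_diff X (gfun f) (frob_inner (Gfun f X *m calA X -
    (1 / 2) *: (X *m (X^T *m Gfun f X + (Gfun f X)^T *m X)))).
Proof.
move=> df; set V := (X in frob_inner X).
apply: (is_diff_fun (is_diff_comp (is_diff_mul_calA X) (differentiableP (df _)))) => //.
move=> D; rewrite /= diffE_grad -/(Gfun f X) /V; set G := Gfun f X.
rewrite frob_innerDr frob_innerDl frob_innerNr frob_innerNl; congr (_ - _).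
  by rewrite frob_inner_mulmxr calA_sym.
rewrite frob_innerZl frob_innerZr; congr (_ * _).
rewrite frob_inner_mulmxl [LHS]frob_innerC [RHS]frob_innerC.
rewrite frob_inner_mulmxl frob_innerDl frob_innerDr addrC; congr (_ + _).
by rewrite -frob_inner_tr !trmx_mul !trmxK.
Qed.

Lemma is_diff_penalty (beta : R) X :
  is_diff X (fun Y => beta / 4 * normF (Y^T *m Y - 1%:M) ^+ 2)
    (frob_inner (beta *: (X *m (X^T *m X - 1%:M)))).
Proof.
have dP := is_diffB (is_diff_gram X) (is_diff_cst (1%:M : 'M[R]_p) X).
apply: (is_diff_fun (is_diffZ (beta / 4) (is_diff_frob_inner dP dP))).
  by move=> Y; rewrite sqr_normF.
move=> D; rewrite /= !fctE subr0.
rewrite [frob_inner (_ - _) _]frob_innerC; set P1 := X^T *m X - 1%:M.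
have P1sym : P1^T = P1 by rewrite /P1 linearB /= trmx_mul trmxK trmx1.
(* Since X^T X - I is symmetric, D^T X and its transpose X^T D pair equally with it. This factor 2
   and the one from squaring cancel the 4 in beta / 4. *)
have -> : frob_inner (D^T *m X + X^T *m D) P1 = 2 * frob_inner (X *m P1) D.
  rewrite frob_innerDl -[X in X + _]frob_inner_tr P1sym trmx_mul trmxK.
  rewrite frob_inner_mulmxl trmxK frob_innerC; lra.
by rewrite frob_innerZl /GRing.scale /=; field.
Qed.

Lemma grad_gfun f X : (forall Y, differentiable f Y) ->
  grad (gfun f) X = Gfun f X *m calA X -
    (1 / 2) *: (X *m (X^T *m Gfun f X + (Gfun f X)^T *m X)).
Proof. by move=> df; apply: grad_is_diff; exact: is_diff_gfun. Qed.

(** An equality of functions rather than of values at one point, because the Hessian differentiates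
    it. *)
Lemma grad_hfun f beta : (forall Y, differentiable f Y) ->
  grad (hfun f beta) =
  (fun Y => grad (gfun f) Y + beta *: (Y *m (Y^T *m Y - 1%:M))).
Proof.
move=> df; apply/funext => X; apply: grad_is_diff; rewrite grad_gfun //.
apply: (is_diff_fun (is_diffD (is_diff_gfun X df) (is_diff_penalty beta X))) => // D.
by rewrite [RHS]frob_innerDl.
Qed.

(** Twice differentiability of f enters here: the closed form of the gradient of g combines
    [grad f], composed with a polynomial map, with matrix products and transposes. *)
Lemma differentiable_grad_gfun f X : (forall Y, differentiable f Y) ->
  (forall Y, differentiable (grad f) Y) -> differentiable (grad (gfun f)) X.
Proof.
move=> df ddf.
have -> : grad (gfun f) = (fun Y => Gfun f Y *m calA Y -
    (1 / 2) *: (Y *m (Y^T *m Gfun f Y + (Gfun f Y)^T *m Y))).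
  by apply/funext => Y; exact: grad_gfun.
have dG := is_diff_comp (is_diff_mul_calA X) (differentiableP (ddf _)).
have dT := is_diff_linear (@trmx R n p) (is_diff_id X).
have dGT := is_diff_linear (@trmx R n p) dG.
have dA := is_diffB (is_diff_cst ((3 / 2) *: 1%:M) X)
  (is_diffZ (1 / 2) (is_diff_gram X)).
have dS := is_diffD (is_diff_mulmx dT dG) (is_diff_mulmx dGT (is_diff_id X)).
have [d _] := is_diffB (is_diff_mulmx dG dA)
  (is_diffZ (1 / 2) (is_diff_mulmx (is_diff_id X) dS)).
exact: d.
Qed.

Lemma hess_quad_hfun f beta X D : (forall Y, differentiable f Y) ->
  (forall Y, differentiable (grad f) Y) ->
  hess_quad (hfun f beta) X D = hess_quad (gfun f) X D +
    beta * (frob_inner D (D *m (X^T *m X - 1%:M)) +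
            frob_inner D (X *m (D^T *m X + X^T *m D))).
Proof.
move=> df ddf; rewrite /hess_quad.
have dg := differentiableP (differentiable_grad_gfun X df ddf).
have dP := is_diffB (is_diff_gram X) (is_diff_cst (1%:M : 'M[R]_p) X).
have [_ dh] : is_diff X (grad (hfun f beta)) (fun D => 'd (grad (gfun f)) X D +
    beta *: (D *m (X^T *m X - 1%:M) + X *m (D^T *m X + X^T *m D))).
  apply: (is_diff_fun (is_diffD dg (is_diffZ beta (is_diff_mulmx (is_diff_id X) dP)))).
    by move=> Y; rewrite (grad_hfun _ df).
  by move=> E; rewrite /= !fctE subr0.
apply: etrans (congr1 (fun L => frob_inner D (L D)) dh) _.
by rewrite frob_innerDr frob_innerZr frob_innerDr.
Qed.

End Gradients.

(** * Lipschitz bounds and the spectrum of X^T X at a stationary point *)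

Section StationaryPoints.
Context {R : realType} {n p : nat}.
Implicit Types (X Y D : 'M[R]_(n, p)) (f F : 'M[R]_(n, p) -> R).

(** The Hessian form is the derivative along D of Y -> <D, grad F Y>. Cauchy-Schwarz bounds its
    difference quotients by |D| c, and the bound passes to the limit. *)
Lemma hess_quad_le_lipschitz F X D (c d : R) :
  differentiable (grad F) X -> 0 < d ->
  (forall t, t != 0 -> `|t| < d ->
     normF (grad F (X + t *: D) - grad F X) <= c * `|t|) ->
  `|hess_quad F X D| <= normF D * c.
Proof.
move=> dF d0 lipF.
have [dphi dphiE] := is_diff_linear (frob_inner D) (differentiableP dF).
pose phi Y := frob_inner D (grad F Y).
have /cvg_norm cphi : derivable phi X D by exact: diff_derivable.
have -> : hess_quad F X D = 'D_D phi X.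
  by rewrite deriveE // dphiE.
rewrite -(cvg_lim _ cphi)//; apply: limr_le.
  by apply/cvg_ex; eexists; exact: cphi.
near=> t.
have t0 : t != 0 by near: t; exact: nbhs_dnbhs_neq.
have td : `|t| < d by near: t; exact: dnbhs0_lt.
rewrite /= (addrC (t *: D)) /phi -frob_innerNr -frob_innerDr normrZ normfV.
rewrite ler_pdivrMl ?normr_gt0 //.
apply: le_trans (frob_CauchySchwarz _ _) _.
by rewrite mulrCA ler_wpM2l ?normF_ge0 // mulrC lipF.
Unshelve. all: by end_near. Qed.

Lemma M1_ge f X (beta : R) : (beta_bar f <= beta%:E)%E -> Omega n p X ->
  12 * normF (Gfun f X) <= beta.
Proof.
rewrite /beta_bar ge_max => /andP[M1b _] OX.
rewrite -lee_fin EFinM; apply: le_trans M1b.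
by apply: lee_wpmul2l; rewrite ?lee_fin //; apply: ereal_sup_ubound; exists X.
Qed.

Lemma M2_ge f X Y (beta : R) : (beta_bar f <= beta%:E)%E -> Omega n p X ->
  Omega n p Y -> X != Y ->
  6 * normF (grad (gfun f) X - grad (gfun f) Y) <= beta * normF (X - Y).
Proof.
rewrite /beta_bar ge_max => /andP[_ M2b] OX OY XY.
rewrite -ler_pdivrMr ?normF_gt0 ?subr_eq0 // -mulrA -lee_fin EFinM.
apply: le_trans M2b; apply: lee_wpmul2l; rewrite ?lee_fin //.
by apply: ereal_sup_ubound; exists X, Y.
Qed.

(** A contraction leaves a margin of 1/12 in spectral norm, and the Frobenius norm of D dominates
    its spectral norm. *)
Lemma Omega_near_contraction X D : (0 < p)%N ->
  (forall w : 'cV[R]_p, normF (X *m w) <= normF w) ->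
  normF D <= 12^-1 -> Omega n p (X + D).
Proof.
move=> p0 X1 D1; apply: ge_sup.
  (* [ge_sup] requires a nonempty set of values; p > 0 provides a unit basis vector. *)
  pose e : 'cV[R]_p := delta_mx (Ordinal p0) 0.
  exists (normF ((X + D) *m e)), e => //.
  by apply/normF1; rewrite frob_inner_delta mxE !eqxx.
move=> _ [v /= v1 <-]; rewrite mulmxDl; apply: le_trans (normFD _ _) _.
rewrite lerD //; first by rewrite -v1.
by apply: le_trans (normF_mul_vec _ _) _; rewrite v1 mulr1.
Qed.

Lemma stationary_gram_eigenvalue f (beta : R) X (v : 'cV[R]_p) (lam : R) :
  (forall Y, differentiable f Y) -> 0 < beta -> 12 * normF (Gfun f X) <= beta ->
  grad (hfun f beta) X = 0 -> normF v = 1 -> X^T *m X *m v = lam *: v ->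
  lam = normF (X *m v) ^+ 2 /\ (lam = 1 \/ lam <= 64^-1).
Proof.
move=> df beta0 Gb h0 v1 Pv.
have vv : frob_inner v v = 1 by apply/normF1.
have lamE : lam = normF (X *m v) ^+ 2.
  by rewrite sqr_normF frob_inner_mulmxl mulmxA Pv frob_innerZr vv mulr1.
split => //; rewrite grad_hfun // grad_gfun // in h0.
have := congr1 (fun A => frob_inner (X *m v) (A *m v)) h0.
rewrite mul0mx linear0; set G := Gfun f X in Gb *.
set tau := frob_inner (X *m v) (G *m v).
have Av : calA X *m v = (3 / 2 - lam / 2) *: v.
  rewrite /calA mulmxBl -!scalemxAl Pv mul1mx scalerA scalerBl.
  by congr (_ - _ *: _); rewrite mulrAC mul1r.
rewrite mulmxDl mulmxBl -mulmxA Av -!scalemxAl -!mulmxA.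
rewrite !(frob_innerDr, frob_innerNr, frob_innerZr).
rewrite -scalemxAr frob_innerZr -/tau.
have XX (w : 'cV[R]_p) : frob_inner (X *m v) (X *m w) = lam * frob_inner v w.
  by rewrite frob_innerC frob_inner_mulmxl mulmxA Pv frob_innerZr frob_innerC.
rewrite !XX !mulmxDl mulNmx mul1mx Pv !frob_innerDr frob_innerNr.
rewrite frob_innerZr vv.
have -> : frob_inner v (X^T *m G *m v) = tau.
  by rewrite -mulmxA -frob_inner_mulmxl.
have -> : frob_inner v (G^T *m X *m v) = tau.
  by rewrite -mulmxA -frob_inner_mulmxl frob_innerC.
move=> eq0.
(* The three contributions are (3/2 - lam/2) tau from G [calA], - lam tau from the symmetrised term
   and beta lam (lam - 1) from the penalty. *)
have {eq0} : (lam - 1) * (beta * lam - 3 / 2 * tau) = 0 by rewrite -[RHS]eq0; field.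
move=> /eqP; rewrite mulf_eq0 => /orP[|].
  by rewrite subr_eq0 => /eqP; left.
move=> /eqP tauE; right.
have taub : tau <= normF (X *m v) * normF G.
  apply: le_trans (ler_norm _) _; apply: le_trans (frob_CauchySchwarz _ _) _.
  rewrite ler_wpM2l ?normF_ge0 //; apply: le_trans (normF_mul_vec _ _) _.
  by rewrite v1 mulr1.
rewrite lamE in tauE *.
have [s0|s0] := eqVneq (normF (X *m v)) 0; first by rewrite s0 expr0n /= invr_ge0.
have {}s0 : 0 < normF (X *m v) by rewrite lt_def s0 normF_ge0.
move: (normF (X *m v)) (normF G) s0 taub tauE Gb => s g s0 taub tauE Gb.
clear -beta0 s0 taub tauE Gb.
(* Here s = |Xv| and g = |G|: beta s^2 = (3/2) tau <= (3/2) s g <= beta s / 8, hence s <= 1/8 and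
   lam = s^2 <= 1/64. *)
have s8 : 8 * s <= 1.
  rewrite -(ler_pM2l (mulr_gt0 beta0 s0)); nra.
rewrite expr2; nra.
Qed.

Lemma stationary_contraction f (beta : R) X (w : 'cV[R]_p) :
  (0 < p)%N -> (forall Y, differentiable f Y) -> 0 < beta ->
  12 * normF (Gfun f X) <= beta -> grad (hfun f beta) X = 0 ->
  normF (X *m w) <= normF w.
Proof.
move=> p0 df beta0 Gb h0.
(* The least eigenvalue of - X^T X is minus the largest eigenvalue of X^T X; both alternatives for
   the latter are at most 1. *)
have [|v [lam [v1 Sv max]]] := min_eigenvector (S := - (X^T *m X)) p0.
  by rewrite linearN /= trmx_mul trmxK.
have Pv : X^T *m X *m v = (- lam) *: v.
  by rewrite scaleNr -Sv mulNmx opprK.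
have [_ lam1] := stationary_gram_eigenvalue df beta0 Gb h0 v1 Pv.
rewrite -(@ler_pXn2r _ 2) ?nnegrE ?normF_ge0 // !sqr_normF.
rewrite frob_inner_mulmxl.
have := max w; rewrite mulNmx frob_innerNr mulmxA.
have := frob_inner_ge0 w; move: (frob_inner w w) (frob_inner w _) => a b.
by clear -lam1; case: lam1 => [|] ? ? ?; nra.
Qed.

(** If Xv is nonzero, its normalisation u works, since X^T u = (lam / |Xv|) v and lam = |Xv|^2. If
    Xv = 0, then lam = 0 and any unit vector of the left kernel of X works. *)
Lemma exists_small_left_vector X (v : 'cV[R]_p) (lam : R) :
  (p <= n)%N -> normF v = 1 -> X^T *m X *m v = lam *: v ->
  lam = normF (X *m v) ^+ 2 ->
  exists u : 'cV[R]_n, normF u = 1 /\ normF (X^T *m u) ^+ 2 = lam.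
Proof.
move=> pn v1 Pv lamE; have [lam0|lam0] := eqVneq (normF (X *m v)) 0.
  have Xv0 : X *m v = 0.
    by apply/eqP; apply: contraTT (lexx (normF (X *m v))); rewrite -normF_gt0 lam0 ltxx.
  (* Independent rows would mean rank n >= p, hence full column rank and a left inverse of X,
     contradicting Xv = 0 with v a unit vector. *)
  have Xnfree : ~~ row_free X.
    apply/negP => Xfree.
    have Xfull : row_full X.
      by rewrite /row_full eqn_leq rank_leq_col (eqP Xfree).
    have v0 : v = 0 by rewrite -[v]mul1mx -(mulVpmx Xfull) -mulmxA Xv0 mulmx0.
    by move: v1; rewrite v0 normF0 => /eqP; rewrite eq_sym oner_eq0.
  rewrite -kermx_eq0 -nz_row_eq0 in Xnfree.
  set r := nz_row (kermx X) in Xnfree.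
  have rX : r *m X = 0 by apply/sub_kermxP; exact: nz_row_sub.
  have r0 : 0 < normF r by rewrite normF_gt0.
  exists ((normF r)^-1 *: r^T); split.
    by rewrite normFZ normF_tr gtr0_norm ?invr_gt0 // mulVf // gt_eqF.
  rewrite -scalemxAr -trmx_mul rX linear0 scaler0 normF0 lamE lam0.
  by rewrite expr0n.
have s0 : 0 < normF (X *m v) by rewrite lt_def lam0 normF_ge0.
exists ((normF (X *m v))^-1 *: (X *m v)); split.
  by rewrite normFZ gtr0_norm ?invr_gt0 // mulVf.
rewrite -scalemxAr mulmxA Pv scalerA normFZ v1 mulr1 real_normK ?num_real //.
by rewrite lamE; field.
Qed.

End StationaryPoints.

(** * Bounds on the Hessian of h and the direction of negative curvature *)

Section PenaltyHessian.
Context {R : realType} {n p : nat}.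
Implicit Types (X D : 'M[R]_(n, p)) (f : 'M[R]_(n, p) -> R).

(** In this form only - |D|^2 and the trace term can be negative, and [frob_inner_self_tr] controls
    the trace term by the last square. *)
Lemma hess_penaltyE X D :
  frob_inner D (D *m (X^T *m X - 1%:M)) +
  frob_inner D (X *m (D^T *m X + X^T *m D)) =
  normF (D *m X^T) ^+ 2 - normF D ^+ 2 +
  frob_inner (X^T *m D) (X^T *m D)^T + normF (X^T *m D) ^+ 2.
Proof.
rewrite !sqr_normF mulmxBr mulmx1 frob_innerDr frob_innerNr.
rewrite mulmxDr frob_innerDr -!addrA; congr (_ + (_ + (_ + _))).
- by rewrite mulmxA [RHS]frob_inner_mulmxr trmxK.
- by rewrite trmx_mul trmxK frob_inner_mulmxl trmxK.
- by rewrite frob_inner_mulmxl trmxK.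
Qed.

Lemma gram_neq1_gt0 X : X^T *m X != 1%:M -> (0 < p)%N.
Proof.
rewrite lt0n; apply: contraNneq => p0; apply/eqP/matrixP => -[i ilt].
by exfalso; move: ilt; rewrite p0.
Qed.

Lemma frob_inner_self_tr (m : nat) (A : 'M[R]_m) :
  `|frob_inner A A^T| <= normF A ^+ 2.
Proof. by rewrite expr2 -{2}(normF_tr A) frob_CauchySchwarz. Qed.

(** At a stationary point X is a contraction, so every X + t D with |t| < 1/12 stays in [Omega],
    where 6 M2 <= beta supplies the Lipschitz constant beta / 6. *)
Lemma stationary_hess_gfun f (beta : R) X D : (0 < p)%N ->
  (forall Y, differentiable f Y) -> (forall Y, differentiable (grad f) Y) ->
  0 < beta -> (beta_bar f <= beta%:E)%E -> Omega n p X ->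
  grad (hfun f beta) X = 0 -> normF D = 1 ->
  `|hess_quad (gfun f) X D| <= beta / 6.
Proof.
move=> p0 df ddf beta0 betab OX h0 D1.
have Gb := M1_ge betab OX.
suff : `|hess_quad (gfun f) X D| <= normF D * (beta / 6) by rewrite D1 mul1r.
apply: (@hess_quad_le_lipschitz _ _ _ _ _ _ _ 12^-1) => //.
- exact: differentiable_grad_gfun.
move=> t t0 td.
have tD : normF (t *: D) = `|t| by rewrite normFZ D1 mulr1.
have OXt : Omega n p (X + t *: D).
  apply: Omega_near_contraction => //; last by rewrite tD ltW.
  by move=> w; exact: (stationary_contraction _ p0 df beta0 Gb h0).
have XtX : X + t *: D - X = t *: D by rewrite addrAC subrr add0r.
have Xt : X + t *: D != X by rewrite -subr_eq0 XtX -normF_gt0 tD normr_gt0.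
have := M2_ge betab OXt OX Xt.
by rewrite XtX tD mulrAC ler_pdivlMr // mulrC.
Qed.

(** A lower bound uniform over unit directions, which makes the infimum defining [lambda_min]
    meaningful. The penalty contributes at least - beta, because the trace term is absorbed by |X^T
    D|^2. *)
Lemma hess_hfun_ge f (beta : R) X D : (0 < p)%N ->
  (forall Y, differentiable f Y) -> (forall Y, differentiable (grad f) Y) ->
  0 < beta -> (beta_bar f <= beta%:E)%E -> Omega n p X ->
  grad (hfun f beta) X = 0 -> normF D = 1 ->
  - (beta / 6) - beta <= hess_quad (hfun f beta) X D.
Proof.
move=> p0 df ddf beta0 betab OX h0 D1.
have := stationary_hess_gfun p0 df ddf beta0 betab OX h0 D1.
rewrite ler_norml => /andP[gD _].
rewrite hess_quad_hfun // hess_penaltyE D1 expr1n lerD // -mulrN1.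
rewrite ler_pM2l //.
have := frob_inner_self_tr (X^T *m D); rewrite ler_norml => /andP[].
have := sqr_ge0 (normF (D *m X^T)).
by clear; move: (_ ^+ 2) (frob_inner _ _) (_ ^+ 2) => a b c; lra.
Qed.

Lemma stationary_negative_direction f (beta : R) X : (p <= n)%N ->
  (forall Y, differentiable f Y) -> (forall Y, differentiable (grad f) Y) ->
  0 < beta -> (beta_bar f <= beta%:E)%E -> Omega n p X ->
  grad (hfun f beta) X = 0 -> X^T *m X != 1%:M ->
  exists D, normF D = 1 /\ hess_quad (hfun f beta) X D <= - (beta / 24).
Proof.
move=> pn df ddf beta0 betab OX h0 XX1.
have p0 := gram_neq1_gt0 XX1.
have Gb := M1_ge betab OX.
have Psym : (X^T *m X)^T = X^T *m X by rewrite trmx_mul trmxK.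
have [v [lam [v1 Pv min]]] := min_eigenvector p0 Psym.
have [lamE lam1] := stationary_gram_eigenvalue df beta0 Gb h0 v1 Pv.
have {}lam1 : lam <= 64^-1.
  (* If the least eigenvalue were 1, then X^T X >= I; the contraction property gives X^T X <= I, so
     the form of X^T X - I vanishes identically and X^T X = I. *)
  case: lam1 => // lam1; case/eqP: XX1; apply/eqP; rewrite -subr_eq0; apply/eqP.
  apply: sym_quadratic_form_eq0; first by rewrite linearB /= Psym trmx1.
  move=> w; rewrite mulmxBl mul1mx frob_innerDr frob_innerNr; apply/eqP.
  rewrite subr_eq0 eq_le; apply/andP; split; last by have := min w; rewrite lam1 mul1r.
  rewrite -mulmxA -frob_inner_mulmxl -!sqr_normF.
  rewrite ler_pXn2r ?nnegrE ?normF_ge0 //.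
  exact: (stationary_contraction _ p0 df beta0 Gb h0).
have [u [u1 Xu]] := exists_small_left_vector pn v1 Pv lamE.
exists (u *m v^T); have D1 : normF (u *m v^T) = 1.
  by rewrite normF_mul_vecT u1 v1 mulr1.
split => //; rewrite hess_quad_hfun // hess_penaltyE.
have := stationary_hess_gfun p0 df ddf beta0 betab OX h0 D1.
have := frob_inner_self_tr (X^T *m (u *m v^T)).
(* For D = u v^T both |D X^T|^2 = |Xv|^2 and |X^T D|^2 = |X^T u|^2 equal lam, and the trace term is
   at most lam. *)
rewrite D1 -mulmxA -trmx_mul normF_mul_vecT u1 mul1r -lamE.
rewrite mulmxA normF_mul_vecT v1 mulr1 Xu expr1n.
rewrite !ler_norml => /andP[_]; move: (frob_inner _ _) => c cl /andP[_ gD].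
(* The penalty form is at most 3 lam - 1 <= 3/64 - 1, and 1/6 + 3/64 - 1 = -151/192 lies below
   -1/24. *)
apply: le_trans (lerD gD (ler_wpM2l (ltW beta0) (y := 3 / 64 - 1) _)) _.
  by clear -cl lam1; lra.
by clear -beta0; lra.
Qed.

End PenaltyHessian.

Unset Implicit Arguments.

Theorem mainTheorem8 (R : realType) (n p : nat) (f : 'M[R]_(n, p) -> R)
  (beta : R) (Xt : 'M[R]_(n, p)) :
  (* Stiefel setting n >= p *)
  (p <= n)%N ->
  (* standing assumptions: f differentiable, f and grad f locally Lipschitz *)
  (forall X, differentiable f X) ->
  locally_lipschitz f ->
  locally_lipschitz (grad f) ->
  (* f twice differentiable at every point *)
  (forall X, differentiable (grad f) X) ->
  0 < beta ->
  (beta_bar f <= beta%:E)%E ->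
  Omega n p Xt ->
  grad (hfun f beta) Xt = 0 ->
  Xt^T *m Xt != 1%:M ->
  ~ second_order_stationary (hfun f beta) Xt /\
  lambda_min (hfun f beta) Xt <= - (beta / 24).
Proof.
move=> pn df _ _ ddf beta0 betab OX h0 XX1.
have [D [D1 hD]] := stationary_negative_direction pn df ddf beta0 betab OX h0 XX1.
have p0 := gram_neq1_gt0 XX1.
split.
  move=> [_ /(_ D)]; rewrite leNgt => /negP; apply; apply: le_lt_trans hD _.
  by rewrite oppr_lt0 divr_gt0.
(* [inf] takes the default value 0 on a nonempty set unbounded below, so a lower bound must be
   supplied before comparing with the value at D. *)
apply: le_trans hD; apply: ge_inf; last by exists D.
exists (- (beta / 6) - beta) => _ [E E1 <-]; exact: hess_hfun_ge.
Qed.
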